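(* Let $\mathcal{I}$ be a P-ideal on $\omega$. The following are equivalent: (1) $\mathcal{A}_{\mathcal{I}^*}$ has the Nikodym property; (2) $\mathcal{A}_{\mathcal{I}^*}$ has the strong Nikodym property; (3) $\mathcal{A}_{\mathcal{I}^*}$ has the web Nikodym property; (4) $\mathcal{I}$ has the Nikodym property; (5) $\mathcal{I}$ has the strong Nikodym property; (6) $\mathcal{I}$ has the web Nikodym property; (7) $N_{\mathcal{I}^*}$ has the finitely supported Nikodym property.
   Context: Ideals on $\omega$ are proper and contain all finite sets. $\mathcal{I}$ is a P-ideal if for every sequence $(A_n)$ in $\mathcal{I}$ there is $A\in\mathcal{I}$ with $A_n\setminus A$ finite for all $n$. $\mathcal{I}^*=\{\omega\setminus A\colon A\in\mathcal{I}\}$ and $\mathcal{A}_{\mathcal{I}^*}=\mathcal{I}\cup\mathcal{I}^*\subseteq\wp(\omega)$. Both $\mathcal{I}$ and $\mathcal{A}_{\mathcal{I}^*}$ are rings of subsets of $\omega$. For a ring $\mathcal{R}$, $\mathrm{ba}(\mathcal{R})$ is the space of additive $\mu\colon\mathcal{R}\to\mathbb{R}$ with finite norm $\|\mu\|=\sup\{|\mu(A)|+|\mu(B)|\colon A,B\in\mathcal{R},A\cap B=\emptyset\}$. $\mathcal{Q}\subseteq\mathcal{R}$ is a Nikodym set for $\mathrm{ba}(\mathcal{R})$ if every sequence $(\mu_k)$ in $\mathrm{ba}(\mathcal{R})$ with $\mu_k(A)\to0$ for all $A\in\mathcal{Q}$ is norm bounded. $\mathcal{R}$ has the Nikodym property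 if $\mathcal{R}$ itself is a Nikodym set; the strong Nikodym property if for every increasing sequence $(\mathcal{R}_n)$ of subsets of $\mathcal{R}$ with union $\mathcal{R}$ some $\mathcal{R}_{n_0}$ is a Nikodym set; the web Nikodym property if for every web $(\mathcal{R}_\sigma)_{\sigma\in\omega^{<\omega}}$ in $\mathcal{R}$ (subsets with $\mathcal{R}_{\langle\rangle}=\mathcal{R}$ and, for each $\sigma$, $(\mathcal{R}_{\sigma^\frown n})_n$ increasing with union $\mathcal{R}_\sigma$) there are $\sigma_m\in\omega^m$ with $\sigma_{m+1}$ extending $\sigma_m$ and each $\mathcal{R}_{\sigma_m}$ a Nikodym set. $N_{\mathcal{I}^*}=\omega\cup\{p\}$ with points of $\omega$ isolated and neighborhood base $\{A\cup\{p\}\colon A\in\mathcal{I}^*\}$ at $p$. A zero-dimensional space $X$ has the finitely supported Nikodym property if every sequence of finitely supported measures $\mu_n=\sum_{x\in F_n}\alpha_x\delta_x$ (norm $\sum|\alpha_x|$) with $\mu_n(A)\to0$ for every clopen $A\subseteq X$ is norm bounded. *)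

(* Defs.v *)
From HB Require Import structures.
From mathcomp Require Import all_boot all_order all_algebra finmap.
From mathcomp Require Import all_classical all_reals all_analysis.

Set Implicit Arguments.
Unset Strict Implicit.
Unset Printing Implicit Defensive.
Import Order.TTheory GRing.Theory Num.Theory.
Import numFieldNormedType.Exports.

Local Open Scope classical_set_scope.
Local Open Scope ring_scope.

Record is_ideal (I : set (set nat)) : Prop := IsIdeal {
  ideal_proper : ~ I setT ;
  ideal_finite : forall A, finite_set A -> I A ;
  ideal_sub : forall A B, A `<=` B -> I B -> I A ;
  ideal_setU : forall A B, I A -> I B -> I (A `|` B) }.

Definition P_ideal (I : set (set nat)) : Prop :=
  forall A_ : nat -> set nat, (forall n, I (A_ n)) ->
    exists2 A, I A & forall n, finite_set (A_ n `\` A).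

Definition dual_filter (I : set (set nat)) : set (set nat) :=
  [set ~` A | A in I].

Definition ideal_algebra (I : set (set nat)) : set (set nat) :=
  I `|` dual_filter I.

Lemma ideal_setring I : is_ideal I -> setring I.
Proof.
move=> hI; split; first exact/(ideal_finite hI)/finite_set0.
  by move=> A B; exact: ideal_setU.
by move=> A B IA _; apply: (ideal_sub hI _ IA) => x [].
Qed.

Lemma ideal_algebra_setring I : is_ideal I -> setring (ideal_algebra I).
Proof.
move=> hI.
have AE A : ideal_algebra I A <-> I A \/ I (~` A).
  split=> [[|[B IB <-]]|[|IA]]; [by left|by right; rewrite setCK|by left|].
  by right; exists (~` A) => //; rewrite setCK.
split; first by left; apply/(ideal_finite hI)/finite_set0.
- move=> A B /AE[IA|IA] /AE[IB|IB]; apply/AE;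
    [by left; exact: ideal_setU|right|right|right];
    by [apply: (ideal_sub hI _ IA) => x /= /not_orP[]
       |apply: (ideal_sub hI _ IB) => x /= /not_orP[]].
- move=> A B /AE[IA|IA] /AE[IB|IB]; apply/AE;
    [left|left|right|left];
    try by [apply: (ideal_sub hI _ IA) => x []|apply: (ideal_sub hI _ IB) => x []].
  apply: (ideal_sub hI _ (ideal_setU hI IA IB)) => x /= /not_andP[|/contrapT];
    by [left|right].
Qed.

Section nikodym.
Context {R : realType} {T : Type}.
Implicit Types (Rg Q : set (set T)) (mu : set T -> R).

(* A set function on a ring [Rg] is encoded as a total function on [set T];
   everything below depends only on its values on [Rg]. *)
Definition additive_on Rg mu : Prop :=
  forall A B, Rg A -> Rg B -> A `&` B = set0 -> mu (A `|` B) = mu A + mu B.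

Definition ba_norm Rg mu : \bar R :=
  ereal_sup [set x | exists A B, [/\ Rg A, Rg B, A `&` B = set0 &
                                     x = (`|mu A| + `|mu B|)%:E]].

Definition ba Rg : set (set T -> R) :=
  [set mu | additive_on Rg mu /\ (ba_norm Rg mu < +oo)%E].

Definition Nikodym_set Rg Q : Prop :=
  Q `<=` Rg /\
  forall mu_ : nat -> set T -> R,
    (forall k, ba Rg (mu_ k)) ->
    (forall A, Q A -> mu_ k A @[k --> \oo] --> (0 : R)) ->
    exists M : R, forall k, (ba_norm Rg (mu_ k) <= M%:E)%E.

Definition Nikodym Rg : Prop := Nikodym_set Rg Rg.

Definition increasing_cover Rg (Rg_ : nat -> set (set T)) : Prop :=
  (forall n, Rg_ n `<=` Rg_ n.+1) /\ \bigcup_n Rg_ n = Rg.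

Definition strong_Nikodym Rg : Prop :=
  forall Rg_ : nat -> set (set T), increasing_cover Rg Rg_ ->
    exists n0, Nikodym_set Rg (Rg_ n0).

Definition web Rg (W : seq nat -> set (set T)) : Prop :=
  W [::] = Rg /\
  forall s, increasing_cover (W s) (fun n => W (rcons s n)).

Definition web_Nikodym Rg : Prop :=
  forall W : seq nat -> set (set T), web Rg W ->
    exists s_ : nat -> seq nat,
      [/\ forall m, size (s_ m) = m,
          forall m, prefix (s_ m) (s_ m.+1) &
          forall m, Nikodym_set Rg (W (s_ m))].

End nikodym.

Arguments Nikodym R {T} Rg.
Arguments strong_Nikodym R {T} Rg.
Arguments web_Nikodym R {T} Rg.

(* The [n]-th measure is the sum over [x] in [F n] of [alpha n x] times the
   Dirac measure at [x], whose value on [A] is [\1_A x]. *)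
Definition fs_Nikodym (R : realType) (X : topologicalType) : Prop :=
  forall (F : nat -> {fset X}) (alpha : nat -> X -> R),
    (forall A : set X, clopen A ->
       (\sum_(x <- F n) alpha n x * \1_A x) @[n --> \oo] --> (0 : R)) ->
    exists M : R, forall n, \sum_(x <- F n) `|alpha n x| <= M.

(* [Some n] stands for [n] and [None] for the point [p] at infinity. *)
Definition N_space (I : set (set nat)) (hI : is_ideal I) : Type := option nat.

Section N_space_topology.
Context (I : set (set nat)) (hI : is_ideal I).
Local Notation N := (N_space hI).

HB.instance Definition _ := Choice.copy N (option nat).

Definition N_nbhs (x : N) : set (set N) :=
  if x is Some n then [set U | U (Some n)]
  else [set U | exists2 A, dual_filter I A & Some @` A `|` [set None] `<=` U].

HB.instance Definition _ := hasNbhs.Build N N_nbhs.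

Let N_nbhs_singleton (x : N) (U : set N) : nbhs x U -> U x.
Proof. by case: x => [n//|[A _]]; apply; right. Qed.

Let N_nbhs_filter (x : N) : ProperFilter (nbhs x).
Proof.
split; first by move=> /N_nbhs_singleton.
case: x => [n|]; first by split=> // U V sUV Un; exact: sUV.
split.
- exists setT => //; exists set0; last by rewrite setC0.
  exact/(ideal_finite hI)/finite_set0.
- move=> U V [_ [A IA <-] AU] [_ [B IB <-] BV].
  exists (~` (A `|` B)); first by exists (A `|` B) => //; exact: ideal_setU.
  move=> _ [[n nAB <-]|->]; last by split; [apply: AU|apply: BV]; right.
  by split; [apply: AU|apply: BV]; left; exists n => // ?; apply: nAB;
    [left|right].
- by move=> U V sUV [A IA AU]; exists A => //; exact: subset_trans sUV.
Qed.

Let N_nbhs_nbhs (x : N) (U : set N) : nbhs x U -> nbhs x (nbhs^~ U).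
Proof.
case: x => [n//|[A IA AU]]; exists A => // -[n An|_].
  by apply: AU; case: An => // An; left.
by exists A.
Qed.

HB.instance Definition _ := Nbhs_isNbhsTopological.Build N
  N_nbhs_filter N_nbhs_singleton N_nbhs_nbhs.

Lemma N_zero_dimensional : zero_dimensional N.
Proof.
have cS n : clopen [set (Some n : N)].
  split; first by rewrite openE => _ ->.
  rewrite -openC openE => -[m //|_]; exists (~` [set n]).
    by exists [set n] => //; exact/(ideal_finite hI)/finite_set1.
  by move=> _ [[m /= mn <-]|-> //] [/mn].
move=> [n|] y xy.
  by exists [set (Some n : N)]; split=> //= yx; rewrite yx eqxx in xy.
case: y xy => [n _|]; last by rewrite eqxx.
exists (~` [set (Some n : N)]); split=> //; last by apply.
by rewrite /clopen openC closedC; split; case: (cS n).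
Qed.

End N_space_topology.

(* Main.v *)
(* Clopen subsets of [N_space hI] are traces of members of [ideal_algebra I], and
   a bounded additive function on [I] extends to [ideal_algebra I] with total mass
   0; so everything reduces to deriving the web property of both rings from the
   finitely supported one.

   Given a web [W], call a family large if every subfamily of the ring that is
   closed under disjoint unions and proper differences, has the Baire property
   in a suitable sense, and contains it, is the whole ring.  The root of the web
   is large, so it suffices that a large family is a Nikodym set, and that one
   term of an increasing cover of a large family is large.

   Both steps rest on a uniform boundedness principle on the power set of a
   member [B] of [I].  If it fails, a splitting argument gives disjoint subsets
   [D k] of [B] violating worse and worse bounds; by Drewnowski's lemma one may
   assume that the countably many additive functions involved are continuous in
   [x] on the unions of the [D k], [k] in [x].  For each [k], one of [x] and
   [flip k x] violates the [k]-th bound, so by the Baire property a generic [x]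
   violates infinitely many of them.

   The step from single members [B] of [I] to all of [I] uses that [I] is a
   P-ideal: countably many [A k] in [I] are almost contained in one [B], and the
   finite remainders carry finitely supported measures, to which the finitely
   supported Nikodym property applies. *)

Require Import Defs.
From mathcomp Require Import all_boot all_order all_algebra finmap.
From mathcomp Require Import all_classical all_reals all_analysis.
From mathcomp Require Import zify lra.

Set Implicit Arguments.
Unset Strict Implicit.
Unset Printing Implicit Defensive.
Import Order.TTheory GRing.Theory Num.Theory.
Import numFieldNormedType.Exports.

Local Open Scope classical_set_scope.
Local Open Scope ring_scope.

(** * Dependent choice and unbounded sets of indices *)

Lemma dependent_choice_nat T (P : nat -> T -> Prop)
    (S : nat -> T -> T -> Prop) x0 :
    P 0%N x0 -> (forall n x, P n x -> exists2 y, P n.+1 y & S n x y) ->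
  exists f : nat -> T,
    [/\ f 0%N = x0, forall n, P n (f n) & forall n, S n (f n) (f n.+1)].
Proof.
move=> Px0 step.
have /choice[g gP] : forall p : nat * T, exists y,
    P p.1 p.2 -> P p.1.+1 y /\ S p.1 p.2 y.
  move=> [n x] /=; have [Px|nPx] := pselect (P n x); last by exists x.
  by have [y Py Sy] := step n x Px; exists y.
pose f := fix f n := if n is m.+1 then g (m, f m) else x0.
have Pf n : P n (f n) by elim: n => //= n Pn; have [] := gP (n, f n) Pn.
by exists f; split=> // n; have [] := gP (n, f n) (Pf n).
Qed.

Definition unbounded_nat (S : set nat) : Prop :=
  forall n, exists2 k, (n <= k)%N & S k.

(** * Baire category in the Cantor space of subsets of [nat] *)

(** For fixed [x] and [n] these [y] form a basic clopen set (cylinder) of the product topology, so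
    openness and density below are phrased through finite prefixes. *)
Definition agree n (x y : set nat) : Prop := forall i, (i < n)%N -> x i = y i.

Lemma agree_trans n y x z : agree n x y -> agree n y z -> agree n x z.
Proof. by move=> xy yz i ni; rewrite xy// yz. Qed.

Lemma agree_le m n x y : (m <= n)%N -> agree n x y -> agree m x y.
Proof. by move=> mn xy i im; apply: xy; apply: leq_trans mn. Qed.

Definition cantor_open (U : set (set nat)) : Prop :=
  forall x, U x -> exists n, forall y, agree n x y -> U y.

Definition cantor_dense (U : set (set nat)) : Prop :=
  forall x n, exists2 y, agree n x y & U y.

Definition comeager (C : set (set nat)) : Prop :=
  exists U : nat -> set (set nat),
    (forall k, cantor_open (U k) /\ cantor_dense (U k)) /\ \bigcap_k U k `<=` C.

Lemma comeager_open_dense U : cantor_open U -> cantor_dense U -> comeager U.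
Proof. by move=> Uo Ud; exists (fun=> U); split=> // x Ux; exact: (Ux 0%N I). Qed.

Lemma comeagerT : comeager setT.
Proof.
by apply: comeager_open_dense => [x _|x n]; [exists 0%N|exists x].
Qed.

Lemma comeager_sub C C' : C `<=` C' -> comeager C -> comeager C'.
Proof.
by move=> CC' [U [Uo UC]]; exists U; split=> //; apply: subset_trans CC'.
Qed.

Lemma comeager_bigcap (C : nat -> set (set nat)) :
  (forall n, comeager (C n)) -> comeager (\bigcap_n C n).
Proof.
move=> /choice[U UP].
(* [k] codes a pair [(i, j)]; a number coding no pair contributes the whole space, which is open and
   dense. *)
exists (fun k => if (choice.unpickle k : option (nat * nat)) is Some (i, j)
                 then U i j else setT).
split=> [k|x Ux n _].
  case: choice.unpickle => [[i j]|]; first by have [] := UP i.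
  by split=> [x _|x n]; [exists 0%N|exists x].
have [_] := UP n; apply=> j _.
by have := Ux (choice.pickle (n, j)) I; rewrite choice.pickleK.
Qed.

Lemma comeagerI C C' : comeager C -> comeager C' -> comeager (C `&` C').
Proof.
move=> mC mC'; apply: (@comeager_sub (\bigcap_n if n is 0%N then C else C')).
  by move=> x Cx; split; [have := Cx 0%N I|have := Cx 1%N I].
by apply: comeager_bigcap => -[].
Qed.

(** The Baire category theorem: nested cylinders are chosen, each step [k] entering [U k], and their
    prefixes converge to a point of all the [U k]. *)
Lemma comeager_dense C : comeager C -> cantor_dense C.
Proof.
move=> [U [UP UC]] x0 n0.
pose S k (p q : set nat * nat) := [/\ (p.2 < q.2)%N, agree p.2 p.1 q.1 &
  forall z, agree q.2 q.1 z -> U k z].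
have [k [x n] _|f [f0 _ fS]] :=
  @dependent_choice_nat (set nat * nat)%type (fun _ _ => True) S (x0, n0) I.
  have [Uo Ud] := UP k; have [y xy Uy] := Ud x n; have [m mO] := Uo _ Uy.
  exists (y, maxn n.+1 m) => //; split=> //=; first by lia.
  by move=> z yz; apply: mO; apply: agree_le yz; lia.
have fle i j : (i <= j)%N -> ((f i).2 + (j - i) <= (f j).2)%N /\
    agree (f i).2 (f i).1 (f j).1.
  move=> /subnK <-; elim: (j - i)%N => [|d [le ag]].
    by split=> //; rewrite add0n; lia.
  have [lt ag' _] := fS (d + i)%N; rewrite addSn; split; first by lia.
  by apply: agree_trans ag _; apply: agree_le ag'; lia.
(* Prefix lengths grow strictly, so coordinate [i] is settled by stage [i.+1]. *)
pose z : set nat := fun i => (f i.+1).1 i.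
have fz k : agree (f k).2 (f k).1 z.
  move=> i ik; rewrite /z; have [ki|ik'] := leqP k i.+1.
    by have [_ ->] := fle _ _ ki.
  have [_ ->//] := fle _ _ (ltnW ik').
  by have [+ _] := fle 0%N i.+1 isT; lia.
exists z; first by have := fz 0%N; rewrite f0.
by apply: UC => k _; have [_ _ +] := fS k; apply; apply: fz.
Qed.

Definition flip k (x : set nat) : set nat := fun i => if i == k then ~ x i else x i.

Lemma flipK k : involutive (flip k).
Proof.
move=> x; apply/funext => i; rewrite /flip; case: eqP => // _.
exact: notK.
Qed.

Lemma agree_flip n k x y : agree n x y -> agree n (flip k x) (flip k y).
Proof. by move=> xy i /xy; rewrite /flip => ->. Qed.

Lemma agree_flipr n k x : (n <= k)%N -> agree n x (flip k x).
Proof. by move=> nk i; rewrite /flip; case: eqP => // ->; lia. Qed.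

Lemma comeager_flip k C : comeager C -> comeager (flip k @^-1` C).
Proof.
move=> [U [UP UC]]; exists (fun j => flip k @^-1` U j); split=> [j|x Ux].
  have [Uo Ud] := UP j; split=> [x /= Ux|x n].
    by have [n nO] := Uo _ Ux; exists n => y /(agree_flip k); apply: nO.
  have [y xy Uy] := Ud (flip k x) n; exists (flip k y); last by rewrite /= flipK.
  by rewrite -[x](flipK k); exact: agree_flip.
by apply: UC => j _; exact: Ux.
Qed.

Definition rel_open (C X : set (set nat)) : Prop :=
  forall x, C x -> X x -> exists n, forall y, C y -> agree n x y -> X y.

(* Modulo meager sets every set with the Baire property is clopen, so this is
   equivalent to the usual definition by a meager difference to an open set. *)
Definition baire_property (X : set (set nat)) : Prop :=
  exists2 C, comeager C & rel_open C X /\ rel_open C (~` X).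

Lemma rel_open_sub C C' X : C' `<=` C -> rel_open C X -> rel_open C' X.
Proof.
move=> C'C oX x C'x Xx; have [n nX] := oX x (C'C _ C'x) Xx.
by exists n => y /C'C; exact: nX.
Qed.

(** The cylinders on which membership in [X] is constant along [C] have a dense open union [Q]: a
    cylinder meeting [X] inside [C] shrinks to such a cylinder, and any other already is one. On [C]
    intersected with [Q] the complement of [X] is relatively open as well. *)
Lemma rel_open_baire_property C X :
  comeager C -> rel_open C X -> baire_property X.
Proof.
move=> mC oX.
pose Q := [set x | exists n, (forall y, C y -> agree n x y -> X y) \/
                            (forall y, C y -> agree n x y -> ~ X y)].
have mQ : comeager Q.
  apply: comeager_open_dense => [x [n nX]|x n].
    exists n => y xy; exists n.
    by case: nX => nX; [left|right] => z Cz yz; apply: nX => //;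
      apply: agree_trans yz.
  have [[y [xy Cy Xy]]|nX] := pselect (exists y, [/\ agree n x y, C y & X y]).
    by have [m mX] := oX y Cy Xy; exists y => //; exists m; left.
  exists x => //; exists n; right => y Cy xy Xy.
  by apply: nX; exists y.
exists (C `&` Q); first exact: comeagerI.
split; first by apply: rel_open_sub oX => x [].
move=> x [Cx [n [nX|nX]] nXx]; first by exfalso; apply: nXx; exact: nX.
by exists n => y [Cy _]; exact: nX.
Qed.

Lemma open_baire_property X : cantor_open X -> baire_property X.
Proof.
move=> oX; apply: (rel_open_baire_property comeagerT) => x _ Xx.
by have [n nX] := oX x Xx; exists n => y _; exact: nX.
Qed.

Lemma baire_propertyC X : baire_property X -> baire_property (~` X).
Proof. by move=> [C mC [oX oXC]]; exists C => //; rewrite setCK. Qed.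

Lemma baire_property_bigcup (X : nat -> set (set nat)) :
  (forall n, baire_property (X n)) -> baire_property (\bigcup_n X n).
Proof.
move=> bX; have /choice[C CP] : forall n, exists C,
    comeager C /\ rel_open C (X n).
  by move=> n; have [C mC [oX _]] := bX n; exists C.
apply: (@rel_open_baire_property (\bigcap_n C n)).
  by apply: comeager_bigcap => n; have [] := CP n.
move=> x Cx [n _ Xx]; have [_ oX] := CP n.
have [m mX] := oX x (Cx n I) Xx.
by exists m => y Cy xy; exists n => //; apply: mX => //; exact: Cy.
Qed.

(** For each [n], the points having a cylinder whose generic points all lie in one [G k] with
    [n <= k] form a dense open set [E n]. A generic point of all the [E n] is as required. *)
Lemma flip_limsup (G : nat -> set (set nat)) :
    (forall k, baire_property (G k)) -> (forall k x, G k x \/ G k (flip k x)) ->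
  exists x, unbounded_nat [set k | G k x].
Proof.
move=> bG Gflip; have /choice[C CP] : forall k, exists C,
    comeager C /\ rel_open C (G k).
  by move=> k; have [C mC [oX _]] := bG k; exists C.
pose C0 := \bigcap_k C k.
have mC0 : comeager C0 by apply: comeager_bigcap => k; have [] := CP k.
(* All flips of the point are required to be generic too, so that either alternative of [Gflip]
   yields a generic point. *)
have mC1 : comeager (C0 `&` \bigcap_k (flip k @^-1` C0)).
  by apply: comeagerI => //; apply: comeager_bigcap => k; exact: comeager_flip.
pose E n := [set x | exists k p, (n <= k)%N /\
  forall w, C0 w -> agree p x w -> G k w].
have mE n : comeager (E n).
  apply: comeager_open_dense => [x [k [p [nk kp]]]|x p].
    exists p => y xy; exists k, p; split=> // w Cw yw.
    by apply: kp => //; apply: agree_trans yw.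
  have [y xy [C0y C1y]] := comeager_dense mC1 x p.
  (* Since [k] is at least [p], flipping at [k] does not leave the cylinder of length [p]. *)
  pose k := maxn n p.
  have [z [xz C0z Gz]] : exists z, [/\ agree p x z, C0 z & G k z].
    have [Gy|Gy] := Gflip k y; first by exists y.
    exists (flip k y); split=> //; last exact: C1y.
    by apply: agree_trans xy _; apply: agree_flipr; rewrite /k; lia.
  have [_ oG] := CP k; have [q qG] := oG z (C0z k I) Gz.
  exists z => //; exists k, q; split; first by rewrite /k; lia.
  by move=> w Cw; apply: qG; exact: Cw.
have mCE := comeagerI mC0 (comeager_bigcap mE).
have [x _ [C0x Ex]] := comeager_dense mCE set0 0.
exists x => n; have [k [p [nk kp]]] := Ex n I.
by exists k => //; exact: kp.
Qed.

(** * Bounded additive set functions *)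

Section bounded_additive.
Context {R : realType} {T : Type}.
Implicit Types (Rg : set (set T)) (mu : set T -> R).

Lemma ba_norm_le Rg mu M :
  (forall A, Rg A -> `|mu A| <= M) -> (ba_norm Rg mu <= (M + M)%:E)%E.
Proof.
move=> muM; apply: ge_ereal_sup => _ [A [B [RA RB _ ->]]].
by rewrite lee_fin lerD// muM.
Qed.

Lemma le_ba_norm Rg mu M A : Rg set0 -> (ba_norm Rg mu <= M%:E)%E ->
  Rg A -> `|mu A| <= M.
Proof.
move=> R0 muM RA; rewrite -lee_fin; apply: le_trans muM.
apply: (@le_trans _ _ (`|mu A| + `|mu set0|)%:E).
  by rewrite lee_fin lerDl.
by apply: ereal_sup_ubound; exists A, set0; rewrite setI0.
Qed.

(** The norm lies between the supremum of the absolute values and twice that supremum, so a finite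
    norm can be traded for a bound on the values. *)
Lemma baP Rg mu : Rg set0 -> ba Rg mu <->
  additive_on Rg mu /\ exists M, forall A, Rg A -> `|mu A| <= M.
Proof.
move=> R0; split=> -[amu].
  move=> muoo; split=> //.
  have mu0 : (0 <= ba_norm Rg mu)%E.
    apply: (@le_trans _ _ (`|mu set0| + `|mu set0|)%:E).
      by rewrite lee_fin addr_ge0.
    by apply: ereal_sup_ubound; exists set0, set0; rewrite setI0.
  exists (fine (ba_norm Rg mu)) => A; apply: le_ba_norm => //.
  by rewrite fineK// ge0_fin_numE.
by move=> [M muM]; split=> //; apply: le_lt_trans (ba_norm_le muM) (ltry _).
Qed.

Lemma additive_on0 Rg mu : Rg set0 -> additive_on Rg mu -> mu set0 = 0.
Proof.
move=> R0 amu; have := amu _ _ R0 R0 (setI0 _).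
by rewrite setU0 => /eqP; rewrite -subr_eq subrr eq_sym => /eqP.
Qed.

Lemma additive_onD Rg mu A B : setring Rg -> additive_on Rg mu ->
  Rg A -> Rg B -> A `<=` B -> mu (B `\` A) = mu B - mu A.
Proof.
move=> [_ _ RD] amu RA RB AB.
rewrite -{2}(setUIDK B A) (setIidr AB) amu//; [|exact: RD|].
  by rewrite addrAC subrr add0r.
by rewrite setDE setICA setICr setI0.
Qed.

Lemma ba_sub Rg Rg' mu : Rg' `<=` Rg -> ba Rg mu -> ba Rg' mu.
Proof.
move=> RR' [amu muoo]; split=> [A B /RR' RA /RR'|]; first exact: amu.
apply: le_lt_trans muoo; apply: le_ereal_sup => _ [A [B [/RR' RA /RR' RB AB ->]]].
by exists A, B.
Qed.

End bounded_additive.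

(** * Drewnowski's lemma *)

Section drewnowski.
Context {R : realType}.
Implicit Types (f : set nat -> R).


Lemma unbounded_nat_enum (S : nat -> set nat) :
    (forall n, unbounded_nat (S n)) ->
  exists s : nat -> nat, {homo s : i j / (i < j)%N} /\ forall i, S i (s i).
Proof.
move=> uS; have [k0 _ Sk0] := uS 0%N 0%N.
have [n k _|s [_ Ss sS]] := dependent_choice_nat
  (P := S) (S := fun _ j k => (j < k)%N) Sk0.
  by have [j kj Sj] := uS n.+1 k.+1; exists j.
by exists s; split=> //; apply: homo_ltn sS => j i k; apply: ltn_trans.
Qed.

Lemma le_homo_ltn (s : nat -> nat) i :
  {homo s : i j / (i < j)%N} -> (i <= s i)%N.
Proof.
by move=> hs; elim: i => // i IH; apply: leq_ltn_trans IH _; exact: hs.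
Qed.

Lemma homo_ltn_inj (s : nat -> nat) :
  {homo s : i j / (i < j)%N} -> injective s.
Proof.
move=> hs i j sij; have [/hs|/hs|//] := ltngtP i j; by rewrite sij ltnn.
Qed.

(** Otherwise every piece of a partition of part of [S] into infinitely many unbounded pieces
    contains a set of value beyond [e] in modulus; collecting these by sign exceeds the bound
    [M]. *)
Lemma drewnowski_small f M (S : set nat) e :
    additive_on setT f -> (forall A, `|f A| <= M) -> unbounded_nat S -> 0 < e ->
  exists S', [/\ S' `<=` S, unbounded_nat S' &
                 forall E, E `<=` S' -> `|f E| <= e].
Proof.
move=> af fM uS e0; apply: contrapT => noS'.
have [s [hs Ss]] := unbounded_nat_enum (fun=> uS).
(* The 2-adic valuation of the index sorts the enumeration into infinitely many unbounded pieces. *)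
pose piece i := [set s j | j in [set j | logn 2 j = i]].
have pieceS i : piece i `<=` S by move=> _ [j _ <-]; exact: Ss.
have upiece i : unbounded_nat (piece i).
  move=> n; pose j := (2 ^ i * n.*2.+1)%N.
  exists (s j).
    apply: leq_trans (le_homo_ltn _ hs); rewrite /j.
    have : (0 < 2 ^ i)%N by rewrite expn_gt0.
    by move: (2 ^ i)%N => p; nia.
  exists j => //=; rewrite lognM ?expn_gt0// pfactorK// logn_coprime ?addn0//.
  by rewrite coprime2n /= odd_double.
have dpiece i j k : piece i k -> piece j k -> i = j.
  by move=> [a ai <-] [b bj /(homo_ltn_inj hs) ba]; rewrite -ai -bj ba.
have /choice[E EP] : forall i, exists E, E `<=` piece i /\ e < `|f E|.
  move=> i; apply: contrapT => nE; apply: noS'; exists (piece i); split=> // E EP.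
  by rewrite leNgt; apply/negP => fE; apply: nE; exists E.
(* [P] gathers the sets of nonnegative value, [Q] those of negative value; [f P - f Q] is at most
   [M + M], so a large [n] is contradictory. *)
have PQ n : exists P Q : set nat, [/\ P `<=` \bigcup_(i in `I_n) piece i,
    Q `<=` \bigcup_(i in `I_n) piece i & n%:R * e <= f P - f Q].
  elim: n => [|n [P [Q [Pn Qn fPQ]]]].
    by exists set0, set0; split=> //; rewrite mul0r subrr.
  have sub (X : set nat) : X `<=` \bigcup_(i in `I_n) piece i ->
      X `<=` \bigcup_(i in `I_n.+1) piece i.
    move=> + x Xx => /(_ _ Xx)[i /= ni pix]; exists i => //=; exact: ltnW.
  have [En eE] := EP n.
  have subE : E n `<=` \bigcup_(i in `I_n.+1) piece i.
    by move=> x /En pnx; exists n => /=.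
  have dis (X : set nat) : X `<=` \bigcup_(i in `I_n) piece i ->
      f (X `|` E n) = f X + f (E n).
    move=> Xn; apply: af => //; rewrite -subset0 => x [/Xn[i /= ni pix] /En pnx].
    by move: ni; rewrite (dpiece _ _ _ pix pnx) ltnn.
  have [fE|fE] := lerP 0 (f (E n)).
    exists (P `|` E n), Q; split; [|exact: sub|].
      by rewrite subUset; split=> //; exact: sub.
    by rewrite dis//; move: eE; rewrite ger0_norm// -natr1; lra.
  exists P, (Q `|` E n); split; [exact: sub| |].
    by rewrite subUset; split=> //; exact: sub.
  by rewrite dis//; move: eE; rewrite ltr0_norm// -natr1; lra.
have M0 : 0 <= (M + M) / e.
  have Mge0 : 0 <= M by apply: le_trans (fM set0).
  by apply: divr_ge0; [exact: addr_ge0|exact: ltW].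
have := archi_boundP M0; set n := Num.bound _; rewrite ltr_pdivrMr// => ltn.
have [P [Q [_ _ fPQ]]] := PQ n.
have := fM P; have := fM Q; rewrite !ler_norml.
by move=> /andP[? ?] /andP[? ?]; lra.
Qed.

(** This is uniform continuity, which agrees with continuity because the Cantor space is compact. *)
Definition cantor_continuous f : Prop := forall e, 0 < e ->
  exists n, forall x y, agree n x y -> `|f x - f y| <= e.

(* Passing to a sparse set of indices makes countably many bounded additive
   functions behave like countably additive ones. *)
Lemma drewnowski (f : nat -> set nat -> R) :
    (forall j, additive_on setT (f j)) ->
    (forall j, exists M, forall A, `|f j A| <= M) ->
  exists s : nat -> nat, {homo s : i j / (i < j)%N} /\
    forall j, cantor_continuous (fun x => f j (s @` x)).
Proof.
move=> af bf.
(* Step [n] handles the function [f j] and the tolerance [1/(i+1)] coded by [n]; codes of no pair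
   demand nothing. *)
pose small n (S : set nat) :=
  if (choice.unpickle n : option (nat * nat)) is Some (j, i) then
    forall E, E `<=` S -> `|f j E| <= i.+1%:R^-1 else True.
have [||S [_ uS decS]] := @dependent_choice_nat (set nat)
  (fun=> unbounded_nat) (fun n S S' => S' `<=` S /\ small n S') setT.
- by move=> n; exists n.
- move=> n S uS; rewrite /small.
  case: choice.unpickle => [[j i]|]; last by exists S => //; split.
  have [M fM] := bf j.
  have [|S' [S'S uS' fS']] := @drewnowski_small (f j) M S i.+1%:R^-1 (af j) fM uS.
    by rewrite invr_gt0.
  by exists S'.
have [s [hs sS]] := unbounded_nat_enum uS.
have Sle m n : (m <= n)%N -> S n `<=` S m.
  move=> /subnK <-; elim: (n - m)%N => // d IH; rewrite addSn.
  by apply: subset_trans IH; have [] := decS (d + m)%N.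
exists s; split=> // j e e0.
have [i ie] : exists i, i.+1%:R^-1 <= e / 2.
  have e2 : 0 < e / 2 by rewrite divr_gt0.
  have e20 : 0 <= (e / 2)^-1 by rewrite invr_ge0 ltW.
  exists (Num.bound (e / 2)^-1); rewrite -[leRHS]invrK lef_pV2 ?posrE ?invr_gt0//.
  by apply: ltW; apply: lt_le_trans (archi_boundP e20) _; rewrite ler_nat.
pose n := choice.pickle (j, i).
have fn E : E `<=` S n.+1 -> `|f j E| <= i.+1%:R^-1.
  by have [_] := decS n; rewrite /small /n choice.pickleK; apply.
exists n.+1 => x y xy.
(* The indices [s a] with [n < a] lie in [S n.+1], where [f j] is small, so only the coordinates up
   to [n] matter within [e]. *)
have split_f (z : set nat) : f j (s @` z) =
    f j (s @` (z `&` `I_n.+1)) + f j (s @` (z `\` `I_n.+1)).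
  rewrite -af//; first by rewrite -image_setU setUIDK.
  rewrite -subset0 => _ [[a [_ an] <-] [b [_ bn] /(homo_ltn_inj hs) ba]].
  by apply: bn; rewrite ba.
have tail (z : set nat) : `|f j (s @` (z `\` `I_n.+1))| <= i.+1%:R^-1.
  apply: fn => _ [a [_ /negP na] <-]; apply: (Sle _ a) => //.
  by rewrite leqNgt.
have xyE : x `&` `I_n.+1 = y `&` `I_n.+1.
  by apply/seteqP; split=> a [za an]; split=> //; rewrite ?xy// -xy.
rewrite (split_f x) (split_f y) xyE.
have := tail x; have := tail y; move: ie; rewrite !ler_norml.
move: (_ ^-1) => d ie.
by move=> /andP[? ?] /andP[? ?]; apply/andP; split; lra.
Qed.

End drewnowski.

(** * Uniform boundedness on the power set of a member of an ideal *)

Section uniform_boundedness.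
Context {R : realType} (I : set (set nat)) (hI : is_ideal I).
Implicit Types (V : set (set nat)) (D : nat -> set nat).

Lemma ideal0 : I set0.
Proof. exact/(ideal_finite hI)/finite_set0. Qed.

(* [V] is Borel over countably many bounded additive functions, seen through
   the embeddings [x |-> \bigcup_(i in x) D i] of the Cantor space for which
   these functions become continuous. *)
Definition baire_family V : Prop :=
  exists nu : nat -> set nat -> R, (forall j, ba I (nu j)) /\
    forall D, I (\bigcup_i D i) -> trivIset setT D ->
      (forall j, cantor_continuous (fun x => nu j (\bigcup_(i in x) D i))) ->
      baire_property [set x | V (\bigcup_(i in x) D i)].

Lemma baire_family_le mu (r : R) :
  ba I mu -> baire_family [set A | `|mu A| <= r].
Proof.
move=> bmu; exists (fun=> mu); split=> // D _ _ /(_ 0%N) cmu.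
rewrite -[X in baire_property X]setCK; apply: baire_propertyC.
apply: open_baire_property => x /= /negP; rewrite -ltNge => rx.
have e0 : 0 < (`|mu (\bigcup_(i in x) D i)| - r) / 2 by rewrite divr_gt0// subr_gt0.
have [n nP] := cmu _ e0; exists n => y /nP xy; apply/negP; rewrite -ltNge.
have := ler_normD (mu (\bigcup_(i in x) D i) - mu (\bigcup_(i in y) D i))
  (mu (\bigcup_(i in y) D i)).
by rewrite subrK; lra.
Qed.

Lemma baire_familyC V : baire_family V -> baire_family (~` V).
Proof.
move=> [nu [bnu VP]]; exists nu; split=> // D ID tD cD.
exact: baire_propertyC (VP D ID tD cD).
Qed.

(** Merging the sequences of functions through a pairing lets a single choice of [D] serve all the
    families. *)
Lemma baire_family_seq (V : nat -> set (set nat)) :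
    (forall n, baire_family (V n)) ->
  exists nu : nat -> set nat -> R, (forall j, ba I (nu j)) /\
    forall D, I (\bigcup_i D i) -> trivIset setT D ->
      (forall j, cantor_continuous (fun x => nu j (\bigcup_(i in x) D i))) ->
      forall n, baire_property [set x | V n (\bigcup_(i in x) D i)].
Proof.
move=> /choice[nu nuP].
pose nu' k := if (choice.unpickle k : option (nat * nat)) is Some (i, j)
              then nu i j else nu 0%N 0%N.
exists nu'; split=> [k|D ID tD cD n].
  rewrite /nu'; case: choice.unpickle => [[i j]|];
    by [have [] := nuP i|have [] := nuP 0%N].
have [_] := nuP n; apply=> // j.
by have := cD (choice.pickle (n, j)); rewrite /nu' choice.pickleK.
Qed.

Lemma baire_family_bigcup (V : nat -> set (set nat)) :
  (forall n, baire_family (V n)) -> baire_family (\bigcup_n V n).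
Proof.
move=> /baire_family_seq[nu [bnu nuP]]; exists nu; split=> // D ID tD cD.
exact: baire_property_bigcup (nuP D ID tD cD).
Qed.

Lemma baire_family_bigcap (V : nat -> set (set nat)) :
  (forall n, baire_family (V n)) -> baire_family (\bigcap_n V n).
Proof.
move=> bV; rewrite -[X in baire_family X]setCK setC_bigcap.
by apply: baire_familyC; apply: baire_family_bigcup => n; exact: baire_familyC.
Qed.

Section ubp.
(** Two instances are used: the sets [A] with [|mu m A| <= n], where doubling [n] reflects the
    triangle inequality, and families that depend on [m] alone. *)
Variable U : nat -> nat -> set (set nat).
Hypothesis U_baire : forall m n, baire_family (U m n).
Hypothesis U_mono : forall m n n', (n <= n')%N -> U m n `<=` U m n'.
Hypothesis U_setU : forall m n A B, I A -> I B -> A `&` B = set0 ->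
  U m n A -> U m n B -> U m (n + n) (A `|` B).
Hypothesis U_setD : forall m n A B, I B -> A `<=` B ->
  U m n A -> U m n B -> U m (n + n) (B `\` A).

Let bad B := forall n m0, exists m A, [/\ (m0 <= m)%N, A `<=` B & ~ U m n A].

(** Cutting subsets of [B] along [A] combines uniform bounds on the two halves into one on [B]. *)
Let bad_split B A : I B -> A `<=` B -> bad B -> bad A \/ bad (B `\` A).
Proof.
move=> IB AB badB; apply: contrapT => /not_orP[].
move=> /existsNP[n1 /existsNP[m1 g1]] /existsNP[n2 /existsNP[m2 g2]].
have [m [E [mm EB]]] := badB (maxn n1 n2 + maxn n1 n2)%N (maxn m1 m2); apply.
rewrite -(setUIDK E A); apply: U_setU.
- by apply: (ideal_sub hI _ IB) => x [/EB].
- by apply: (ideal_sub hI _ IB) => x [/EB].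
- by rewrite setDE setIACA setICr setI0.
- apply: (U_mono (leq_maxl _ _)); apply: contrapT => nU; apply: g1.
  by exists m, (E `&` A); split=> //; lia.
- apply: (U_mono (leq_maxr _ _)); apply: contrapT => nU; apply: g2.
  exists m, (E `\` A); split=> //; first by lia.
  by move=> x [/EB Bx nAx].
Qed.

(* Neither half of a suitable splitting of [B] lies in [U m n]; one of the
   halves is bad again. *)
Let bad_step B n m0 : I B -> bad B ->
    (exists n0 m1, forall m, (m1 <= m)%N -> U m n0 B) ->
  exists E m, [/\ E `<=` B, bad (B `\` E), (m0 <= m)%N & ~ U m n E].
Proof.
move=> IB badB [n0 [m1 UB]].
pose k := maxn n0 n.
have [m [A [mm AB nUA]]] := badB (k + k)%N (maxn m0 m1).
have UmB : U m k B by apply: U_mono (UB _ _); [exact: leq_maxl|lia].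
have nUA' : ~ U m n A.
  by move=> UA; apply: nUA; apply: U_mono UA; rewrite /k; lia.
have nUBA : ~ U m n (B `\` A).
  move=> UBA; apply: nUA.
  rewrite -(setIidr AB) -setDD; apply: U_setD => //.
  by apply: U_mono UBA; exact: leq_maxr.
have [badA|badBA] := bad_split IB AB badB.
  exists (B `\` A), m; rewrite setDD (setIidr AB); split=> //; lia.
by exists A, m; split=> //; lia.
Qed.

(** On failure, disjoint sets [D k] outside [U (m_ k) (k + k)] are cut off one by one. Drewnowski's
    lemma thins them until the families pull back to sets with the Baire property, and [flip_limsup]
    then produces one union violating infinitely many bounds, against the pointwise hypothesis. *)
Lemma uniform_boundedness_principle B : I B ->
    (forall A, A `<=` B -> exists n m0, forall m, (m0 <= m)%N -> U m n A) ->
  exists n m0, forall m A, (m0 <= m)%N -> A `<=` B -> U m n A.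
Proof.
move=> IB ptB; apply: contrapT => nunif.
have badB : bad B.
  move=> n m0; apply: contrapT => nbad; apply: nunif; exists n, m0 => m A mm AB.
  by apply: contrapT => nU; apply: nbad; exists m, A.
(* states are triples: remaining set, set removed last, its index *)
have [||f [f0 fP fS]] := @dependent_choice_nat (set nat * set nat * nat)%type
  (fun _ p => p.1.1 `<=` B /\ bad p.1.1)
  (fun k p q => [/\ q.1.2 `<=` p.1.1, q.1.1 = p.1.1 `\` q.1.2, (k <= q.2)%N &
                   ~ U q.2 (k + k)%N q.1.2]) (B, set0, 0%N).
- by split.
- move=> k [[C E0] m0] /= [CB badC].
  have IC : I C by exact: ideal_sub CB IB.
  have [E [m [EC badCE km nU]]] := bad_step (k + k) k IC badC (ptB _ CB).
  by exists (C `\` E, E, m) => //=; split=> // x [/CB].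
pose D k := (f k.+1).1.2; pose m_ k := (f k.+1).2.
have Dnot k : ~ U (m_ k) (k + k)%N (D k) by have [] := fS k.
have m_ge k : (k <= m_ k)%N by have [] := fS k.
have Dsub k : D k `<=` (f k).1.1 by have [] := fS k.
have fdec i j : (i <= j)%N -> (f j).1.1 `<=` (f i).1.1.
  move=> /subnK <-; elim: (j - i)%N => // d IH; rewrite addSn.
  by apply: subset_trans IH; have [_ -> _ _] := fS (d + i)%N; move=> x [].
have DB k : D k `<=` B by apply: subset_trans (Dsub k) _; have [] := fP k.
have tD : trivIset setT D.
  have disj i j x : (i < j)%N -> D i x -> D j x -> False.
    move=> ij Dix /Dsub /(fdec _ _ ij).
    by have [_ -> _ _] := fS i; move=> [_].
  move=> i j _ _ [x [Dix Djx]]; have [ij|ji|//] := ltngtP i j.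
    by have := disj _ _ _ ij Dix Djx.
  by have := disj _ _ _ ji Djx Dix.
have [nu [bnu nuP]] := baire_family_seq
  (V := fun k => U (m_ k) k) (fun k => U_baire (m_ k) k).
pose DD x := \bigcup_(i in x) D i.
have IDD x : I (DD x).
  by apply: (ideal_sub hI _ IB) => y [i _ /DB].
have DDI x y : x `&` y = set0 -> DD x `&` DD y = set0.
  move=> xy; rewrite -subset0 => z [[i xi Diz] [j yj Djz]].
  have ij : i = j by apply: tD => //; exists z.
  have : (x `&` y) i by split; [exact: xi|rewrite ij].
  by rewrite xy.
have [||s [hs cs]] := @drewnowski R (fun j x => nu j (DD x)).
- move=> j x y _ _ xy; have [anu _] := bnu j.
  by rewrite /DD bigcup_setU anu//; [exact: IDD|exact: IDD|exact: DDI].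
- move=> j; have /(baP _ ideal0)[_ [M nuM]] := bnu j.
  by exists M => A; apply: nuM; exact: IDD.
have DDs x : DD (s @` x) = \bigcup_(i in x) D (s i) by rewrite /DD bigcup_image.
have tDs : trivIset setT (D \o s).
  by move=> i j _ _ ij; apply: (homo_ltn_inj hs); apply: tD ij.
have bG i : baire_property [set x | ~ U (m_ (s i)) (s i) (DD (s @` x))].
  rewrite (_ : [set x | _] =
    ~` [set x | U (m_ (s i)) (s i) (\bigcup_(k in x) (D \o s) k)]); last first.
    by apply/seteqP; split=> x /=; rewrite DDs.
  apply: baire_propertyC; apply: nuP => //; first by rewrite -DDs; exact: IDD.
  by move=> j e /(cs j)[n nP]; exists n => x y /nP; rewrite !DDs.
have [|x xinf] := flip_limsup bG.
  (* If the unions over [x] and [flip i x] both met the bound [s i], their difference [D (s i)]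
     would meet the doubled bound. *)
  move=> i x /=; rewrite -not_andP => -[Ux Ufx]; apply: (Dnot (s i)).
  have key (y : set nat) : ~ y i -> U (m_ (s i)) (s i) (DD (s @` y)) ->
      U (m_ (s i)) (s i) (DD (s @` flip i y)) ->
      U (m_ (s i)) (s i + s i)%N (D (s i)).
    move=> nyi Uy Ufy.
    have fyE : flip i y = y `|` [set i].
      apply/seteqP; split=> j; rewrite /flip /=; case: eqP => [->|ji].
      - by right.
      - by left.
      - by move=> _.
      - by move=> [].
    have -> : D (s i) = DD (s @` flip i y) `\` DD (s @` y).
      rewrite fyE !DDs bigcup_setU bigcup_set1 setDUl setDv set0U.
      apply/esym/setDidPl; rewrite -subset0 => z [Dz [j yj Djz]].
      have ij : i = j by apply: tDs => //; exists z.
      by apply: nyi; rewrite ij.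
    apply: U_setD => //.
    by rewrite fyE image_setU /DD bigcup_setU; left.
  have [xi|nxi] := pselect (x i); last exact: key nxi Ux Ufx.
  apply: (key (flip i x)); rewrite ?flipK//.
  by rewrite /flip eqxx.
have [|n [m0 Um]] := ptB (DD (s @` x)); first by move=> y [i _ /DB].
have [i ni /=] := xinf (maxn m0 n); apply.
have si := le_homo_ltn i hs.
apply: (@U_mono _ n); first by lia.
by apply: Um; have := m_ge (s i); lia.
Qed.
End ubp.

End uniform_boundedness.

(** * Finitely supported measures *)

Section finitely_supported.
Context {R : realType} (I : set (set nat)) (hI : is_ideal I).

Lemma eq_cvg0 (u v : nat -> R) : u =1 v ->
  u n @[n --> \oo] --> (0 : R) -> v n @[n --> \oo] --> (0 : R).
Proof. by move=> /funext ->. Qed.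

(** The finitely supported property with the point at infinity dropped: only the clopen sets
    avoiding it are tested. *)
Definition ideal_fs_Nikodym : Prop :=
  forall (F : nat -> {fset nat}) (a : nat -> nat -> R),
    (forall A, I A -> (\sum_(i <- F n) a n i * \1_A i) @[n --> \oo] --> (0 : R)) ->
    exists M : R, forall n, \sum_(i <- F n) `|a n i| <= M.

Lemma N_clopenP (A : set (N_space hI)) : clopen A ->
  A None /\ I (~` (Some @^-1` A)) \/ ~ A None /\ I (Some @^-1` A).
Proof.
move=> [oA cA]; have [An|nAn] := pselect (A None); [left|right]; split=> //.
  move: oA; rewrite openE => /(_ _ An) [_ [B IB <-] BA].
  apply: (ideal_sub hI _ IB) => n /= nAn; apply: contrapT => nBn; apply: nAn.
  by apply: BA; left; exists n.
move: cA; rewrite -openC openE => /(_ _ nAn) [_ [B IB <-] BA].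
apply: (ideal_sub hI _ IB) => n /= An; apply: contrapT => nBn.
suff : (~` A) (Some n) by apply.
by apply: BA; left; exists n.
Qed.

Lemma N_clopen_image (A : set nat) :
  I A -> clopen (Some @` A : set (N_space hI)).
Proof.
move=> IA; split; first by rewrite openE => _ [n An <-]; exists n.
rewrite -openC openE => -[n /= nA|_]; first exact: nA.
exists (~` A); first by exists A.
by move=> _ [[n nAn <-]|->] [m Am] // [mn]; apply: nAn; rewrite -mn.
Qed.

(** The point at infinity receives minus the total mass, so a clopen set containing it has minus the
    measure of its complement, which comes from [I]. *)
Lemma fs_Nikodym_ideal : fs_Nikodym R (N_space hI) -> ideal_fs_Nikodym.
Proof.
move=> fsN F a Fa.
pose F' n : {fset N_space hI} := (None |` [fset Some i | i in F n])%fset.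
pose tot n := \sum_(i <- F n) a n i.
pose a' n (x : N_space hI) : R := if x is Some i then a n i else - tot n.
have sumF' n (g : N_space hI -> R) :
    \sum_(x <- F' n) g x = g None + \sum_(i <- F n) g (Some i).
  rewrite /F' big_fsetU1/=; last by apply/imfsetP => -[].
  by rewrite big_imfset//= => i j _ _ [].
have indS (A : set (N_space hI)) i : \1_A (Some i) = \1_(Some @^-1` A) i :> R.
  by rewrite !indicE; congr (_%:R); congr nat_of_bool; apply/idP/idP;
    rewrite !inE.
have [A cA|M FM] := fsN F' a'.
  have [[An IA]|[nAn IA]] := N_clopenP cA.
    have cA' : (- \sum_(i <- F n) a n i * \1_(~` (Some @^-1` A)) i)
        @[n --> \oo] --> (0 : R).
      by rewrite -[X in _ --> X]oppr0; apply: cvgN; exact: Fa.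
    apply: (eq_cvg0 _ cA') => n; rewrite sumF' indicE mem_set// mulr1 /= -!sumrN.
    rewrite -big_split/=; apply: eq_bigr => i _; rewrite indS !indicE in_setC.
    by case: (i \in _); rewrite /= ?mulr1 ?mulr0 ?addNr ?oppr0 ?addr0.
  apply: (eq_cvg0 _ (Fa _ IA)) => n; rewrite sumF' indicE memNset// mulr0 add0r.
  by apply: eq_bigr => i _; rewrite indS.
by exists M => n; apply: le_trans (FM n); rewrite sumF' lerDr; exact: normr_ge0.
Qed.

Lemma cvg_seq_bounded_nat (u : nat -> R) (l : R) :
  u n @[n --> \oo] --> l -> exists k : nat, forall n, `|u n| <= k%:R.
Proof.
move=> ul; have /cvg_seq_bounded/pinfty_ex_gt0[M M0 uM] := cvgP _ ul.
exists (Num.bound M) => n; apply: le_trans (ltW (archi_boundP (ltW M0))).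
exact: uM.
Qed.

Lemma Nikodym_setP (Rg Q : set (set nat)) : Rg set0 ->
  @Nikodym_set R nat Rg Q <-> Q `<=` Rg /\
    forall mu : nat -> set nat -> R, (forall k, ba Rg (mu k)) ->
      (forall A, Q A -> mu k A @[k --> \oo] --> (0 : R)) ->
      exists M, forall k A, Rg A -> `|mu k A| <= M.
Proof.
move=> R0; split=> -[QR nik]; split=> // mu bmu mu0.
  have [M muM] := nik mu bmu mu0; exists M => k A RA.
  exact: le_ba_norm (muM k) RA.
have [M muM] := nik mu bmu mu0; exists (M + M) => k.
exact/ba_norm_le/muM.
Qed.

(** The measures restrict to [I], where they are bounded. The finite positive and negative parts of
    the support lie in [I] and control the mass on the isolated points; the bounded total mass then
    controls the atom at infinity. *)
Lemma ideal_Nikodym_fs : Nikodym R I -> fs_Nikodym R (N_space hI).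
Proof.
move=> /(Nikodym_setP _ (ideal0 hI))[_ nik] F a Fa.
pose mu n A := \sum_(x <- F n) a n x * \1_(Some @` A : set (N_space hI)) x.
have SomeE A i : (Some i \in (Some @` A : set (N_space hI))) = (i \in A).
  apply/idP/idP; rewrite !inE; first by move=> [j Aj [<-]].
  by move=> Ai; exists i.
have NoneE A : (None \in (Some @` A : set (N_space hI))) = false.
  by apply/negP; rewrite inE => -[].
have bmu n : ba I (mu n).
  apply/(baP _ (ideal0 hI)); split=> [A B _ _ AB|].
    rewrite /mu -big_split/=; apply: eq_bigr => -[i|] _; rewrite !indicE.
      rewrite !SomeE in_setU -mulrDr; congr (_ * _).
      have : i \notin A `&` B by rewrite AB notin_setE.
      rewrite in_setI; case: (i \in A); case: (i \in B) => //= _;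
      by rewrite ?addr0 ?add0r.
    by rewrite !NoneE !mulr0 addr0.
  exists (\sum_(x <- F n) `|a n x|) => A _; apply: le_trans (ler_norm_sum _ _ _) _.
  apply: ler_sum => x _; rewrite normrM indicE.
  by case: (x \in _); rewrite ?normr1 ?normr0 ?mulr1 ?mulr0.
have [A IA|M muM] := nik mu bmu; first by apply: Fa; exact: N_clopen_image.
have [K KP] := cvg_seq_bounded_nat (Fa setT clopenT).
(* The first [M + M] bounds the isolated points, selected by [e]; the rest bounds the atom at
   infinity, [K] being a bound for the total mass. *)
exists (M + M + (K%:R + M + M)) => n.
pose e (x : N_space hI) : R := (x != None)%:R.
have sumE : \sum_(x <- F n) `|a n x| * e x <= M + M.
  pose P := [set i | Some i \in F n /\ 0 < a n (Some i)].
  pose Q := [set i | Some i \in F n /\ a n (Some i) < 0].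
  have finS (A : set nat) : (forall i, A i -> Some i \in F n) -> I A.
    move=> AF; apply: (ideal_finite hI).
    apply: (@sub_finite_set _ _ (odflt 0%N @` [set` F n])).
      by move=> i /AF Fi; exists (Some i).
    by apply: finite_image; exact: finite_fset.
  have IP : I P by apply: finS => i [].
  have IQ : I Q by apply: finS => i [].
  have -> : \sum_(x <- F n) `|a n x| * e x = mu n P - mu n Q.
    rewrite /mu -sumrB; apply: eq_big_seq => -[i|] Fi;
      rewrite !indicE /e; last first.
      by rewrite !NoneE !mulr0 subrr.
    rewrite !SomeE /= mulr1.
    have [ai|ai|ai] := ltgtP (a n (Some i)) 0.
    - rewrite (memNset (A := P)) ?(mem_set (A := Q)) ?mulr1 ?mulr0 ?sub0r//.
      + by rewrite ltr0_norm.
      + by move=> [_]; apply/negP; rewrite -leNgt ltW.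
    - rewrite (memNset (A := Q)) ?(mem_set (A := P)) ?mulr1 ?mulr0 ?subr0//.
      + by rewrite gtr0_norm.
      + by move=> [_]; apply/negP; rewrite -leNgt ltW.
    - by rewrite ai normr0 !mul0r subrr.
  by have := muM n _ IP; have := muM n _ IQ; rewrite !ler_norml; lra.
have sumN : \sum_(x <- F n) `|a n x| * (1 - e x) <= K%:R + M + M.
  pose s := Num.sg (a n None).
  have -> : \sum_(x <- F n) `|a n x| * (1 - e x) =
      s * (\sum_(x <- F n) a n x * \1_setT x - \sum_(x <- F n) a n x * e x).
    rewrite -sumrB mulr_sumr; apply: eq_bigr => -[i|] _;
      rewrite /e /= indicE in_setT.
      by rewrite subrr mulr0 subrr mulr0.
    by rewrite subr0 mulr0 subr0 !mulr1 normrEsg.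
  apply: le_trans (ler_norm _) _; rewrite normrM.
  have s1 : `|s| <= 1 by rewrite /s normr_sg; case: (_ != _).
  apply: (@le_trans _ _ 
    (`|\sum_(x <- F n) a n x * \1_setT x - \sum_(x <- F n) a n x * e x|)).
    by rewrite ler_piMl.
  apply: le_trans (ler_normB _ _) _; rewrite -addrA lerD//.
  apply: le_trans sumE; apply: le_trans (ler_norm_sum _ _ _) _.
  by apply: ler_sum => x _; rewrite normrM /e normr_nat.
apply: le_trans (lerD sumE sumN); rewrite -big_split/=; apply: ler_sum => x _.
by rewrite -mulrDr addrC subrK mulr1.
Qed.

End finitely_supported.

(** * Consequences of the finitely supported property for a P-ideal *)

Section P_ideal_web.
Context {R : realType} (I : set (set nat)) (hI : is_ideal I) (hP : P_ideal I).
Hypothesis fsI : @ideal_fs_Nikodym R I.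

Lemma additive_sum_indic (mu : set nat -> R) (s : seq nat) A :
    additive_on I mu -> uniq s ->
  \sum_(i <- s) mu [set i] * \1_A i = mu ([set` s] `&` A).
Proof.
move=> amu; have If (B : set nat) : finite_set B -> I B by exact: ideal_finite.
elim: s => [_|i s IH /= /andP[nis us]].
  by rewrite big_nil (_ : _ `&` _ = set0) ?(additive_on0 (ideal0 hI) amu)//
    -subset0 => x [].
rewrite big_cons IH// indicE.
have -> : [set` i :: s] `&` A = ([set i] `&` A) `|` ([set` s] `&` A).
  rewrite -setIUl; congr (_ `&` A); apply/seteqP; split=> x /=; rewrite inE.
    by case/orP=> [/eqP ->|?]; [left|right].
  by case=> [->|->]; rewrite ?eqxx ?orbT.
rewrite [RHS]amu.
- congr (_ + _); have [iA|niA] := boolP (i \in A).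
    by rewrite mulr1 setIidl// => _ ->; rewrite inE in iA.
  rewrite mulr0 (_ : _ `&` _ = set0) ?(additive_on0 (ideal0 hI) amu)// -subset0.
  by move=> x [/= -> Ai]; move: niA; rewrite notin_setE; apply.
- by apply: If; apply: finite_setIl.
- by apply: If; apply: finite_setIl; exact: finite_seq.
- rewrite -subset0 => x [[/= -> _] [/= si _]].
  by rewrite si in nis.
Qed.

(** Otherwise some values exceed [j * j] on members of [I] almost contained in one [B]. The parts
    inside [B] are bounded by hypothesis; the finite remainders, divided by [j.+1], give finitely
    supported measures tending to 0 on [I], hence of bounded norm. So the values grow at most
    linearly. *)
Lemma ideal_uniformly_bounded (mu : nat -> set nat -> R) :
    (forall k, ba I (mu k)) ->
    (forall B, I B -> exists C, forall k A, A `<=` B -> `|mu k A| <= C) ->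
  exists M, forall k A, I A -> `|mu k A| <= M.
Proof.
move=> bmu locb; apply: contrapT => nM.
have /choice[kA kAP] : forall j : nat, exists p : nat * set nat,
    I p.2 /\ (j * j)%:R < `|mu p.1 p.2|.
  move=> j; apply: contrapT => nkA; apply: nM; exists (j * j)%:R => k A IA.
  by rewrite leNgt; apply/negP => muA; apply: nkA; exists (k, A).
have [B IB finB] := hP (A_ := fun j => (kA j).2) (fun j => (kAP j).1).
pose X j := (kA j).2 `\` B; pose nu j := mu (kA j).1.
have IX j : I (X j) by apply: (ideal_sub hI _ (kAP j).1) => x [].
have sumX j A : \sum_(i <- fset_set (X j)) nu j [set i] / j.+1%:R * \1_A i =
    nu j (X j `&` A) / j.+1%:R.
  have [amu _] := bmu (kA j).1.
  transitivity ((\sum_(i <- fset_set (X j)) nu j [set i] * \1_A i) / j.+1%:R).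
    by rewrite mulr_suml; apply: eq_bigr => i _; rewrite mulrAC.
  by rewrite additive_sum_indic ?fset_uniq// fset_setK//; exact: finB.
have [A IA|M MP] := fsI (F := fun j => fset_set (X j))
  (a := fun j i => nu j [set i] / j.+1%:R).
  have [C CP] := locb A IA.
  apply: (eq_cvg0 (fun j => esym (sumX j A))).
  apply/norm_cvg0P.
  apply: (@squeeze_cvgr _ _ _ _ (fun=> 0) (fun j => C * harmonic j)).
  - near=> j; rewrite normr_ge0 normrM /= (ger0_norm (x := _^-1))//.
    by rewrite /harmonic /= ler_wpM2r// CP// => x [].
  - exact: cvg_cst.
  - by rewrite -[X in _ --> X](mulr0 C); apply: cvgM;
      [exact: cvg_cst|exact: cvg_harmonic].
have [C CP] := locb B IB.
have C0 : 0 <= C by apply: le_trans (CP 0%N set0 (@sub0set _ _)).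
have M0 : 0 <= M by apply: le_trans (MP 0%N); exact: sumr_ge0.
(* Beyond [M + C + 2] the square [j * j] exceeds [C + M * (j + 1)]. *)
have := archi_boundP (addr_ge0 (addr_ge0 M0 C0) (ler0n R 2)).
set j := Num.bound _ => jlt.
have : `|nu j (X j)| / j.+1%:R <= M.
  apply: le_trans (MP j).
  have := sumX j setT; rewrite setIT => /(congr1 Num.norm).
  rewrite normrM (ger0_norm (x := _^-1))// => <-.
  apply: le_trans (ler_norm_sum _ _ _) _; apply: ler_sum => i _.
  by rewrite indicT mulr1.
rewrite ler_pdivrMr//.
have [IA Ageq] := kAP j; have [amu _] := bmu (kA j).1.
have muE : nu j (kA j).2 = nu j ((kA j).2 `&` B) + nu j (X j).
  rewrite -amu ?setUIDK//; first by apply: (ideal_sub hI _ IA) => x [].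
  by rewrite /X setDE setIACA setICr setI0.
have : `|nu j ((kA j).2 `&` B)| <= C by apply: CP => x [].
have := ler_normD (nu j ((kA j).2 `&` B)) (nu j (X j)); rewrite -muE.
move: Ageq; rewrite -/(nu j) natrM -natr1.
by move: (`|nu j (X j)|) (`|nu j _|) (`|nu j _|) => x y z; nra.
Unshelve. all: end_near. Qed.

(** Otherwise the measures [m] times the Dirac mass at [a m], for [m] in [Z], eventually vanish on
    each member of [I], yet their norms are unbounded. *)
Lemma ideal_meets_sequence (Z : set nat) (a : nat -> nat) : unbounded_nat Z ->
  exists2 B, I B & unbounded_nat [set m | Z m /\ B (a m)].
Proof.
move=> uZ; apply: contrapT => nB.
have [A IA|M MP] := fsI
  (F := fun m => if pselect (Z m) then [fset a m]%fset else fset0)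
  (a := fun m _ => m%:R).
  have [m0 m0P] : exists m0, forall m, (m0 <= m)%N -> Z m -> ~ A (a m).
    apply: contrapT => nm0; apply: nB; exists A => // n; apply: contrapT => nk.
    apply: nm0; exists n => m nm Zm Am; apply: nk; by exists m.
  apply: cvg_near_cst; near=> m.
  case: pselect => [Zm|nZm] /=; last by rewrite big_seq_fset0.
  rewrite big_seq_fset1 indicE memNset ?mulr0//; apply: m0P => //.
  by near: m; exact: nbhs_infty_ge.
have M0 : 0 <= M by apply: le_trans (MP 0%N); exact: sumr_ge0.
have [m mM Zm] := uZ (Num.bound M).
have := MP m; case: pselect => // Zm'; rewrite big_seq_fset1 normr_nat.
apply/negP; rewrite -ltNge; apply: lt_le_trans (archi_boundP M0) _.
by rewrite ler_nat.
Unshelve. all: end_near. Qed.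

End P_ideal_web.

(** * Large families and the web Nikodym property *)

Section web_Nikodym.
Context {R : realType} (I : set (set nat)) (hI : is_ideal I) (hP : P_ideal I).
Hypothesis fsI : @ideal_fs_Nikodym R I.
(** [Rg] stands for either [I] or [ideal_algebra I], so that both rings are treated at once. *)
Variable Rg : set (set nat).
Hypothesis RgR : setring Rg.
Hypothesis IRg : I `<=` Rg.
Hypothesis Rg_cases : forall A, Rg A -> I A \/ Rg setT /\ I (~` A).

Let Rg0 : Rg set0. Proof. by case: RgR. Qed.

Definition additive_family (V : set (set nat)) : Prop :=
  [/\ V set0,
      forall A B, Rg A -> Rg B -> A `&` B = set0 -> V A -> V B -> V (A `|` B) &
      forall A B, Rg A -> Rg B -> A `<=` B -> V A -> V B -> V (B `\` A)].

Lemma additive_family_singleton V A : additive_family V -> finite_set A ->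
  ~ V A -> exists2 a, A a & ~ V [set a].
Proof.
move=> [V0 VU _] finA nVA; apply: contrapT => na; apply: nVA.
have aV a : A a -> V [set a].
  by move=> Aa; apply: contrapT => nV; apply: na; exists a.
have finI (B : set nat) : finite_set B -> Rg B.
  by move=> finB; apply: IRg; exact: ideal_finite finB.
suff key (s : seq nat) : (forall a, a \in s -> A a) -> V [set` s].
  by rewrite -(fset_setK finA); apply: key => a; rewrite in_fset_set// inE.
elim: s => [_|a s IH sA].
  by rewrite (_ : [set` _] = set0)// -subset0.
have [as_|nas] := boolP (a \in s).
  rewrite (_ : [set` a :: s] = [set` s]).
    by apply: IH => b bs; apply: sA; rewrite inE bs orbT.
  apply/seteqP; split=> b /=; rewrite inE; last by move=> ->; rewrite orbT.
  by case/orP=> [/eqP ->|].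
rewrite (_ : [set` a :: s] = [set a] `|` [set` s]).
  apply: VU; [by apply: finI|by apply: finI; exact: finite_seq| | |].
  - by rewrite -subset0 => b [/= ->]; apply/negP.
  - by apply: aV; apply: sA; rewrite inE eqxx.
  - by apply: IH => b bs; apply: sA; rewrite inE bs orbT.
apply/seteqP; split=> b /=; rewrite inE.
  by case/orP=> [/eqP ->|?]; [left|right].
by case=> [->|->]; rewrite ?eqxx ?orbT.
Qed.

Definition large (Q : set (set nat)) : Prop :=
  forall V, Q `<=` V -> additive_family V -> @baire_family R I V -> Rg `<=` V.

(** Largeness applied to the family [V] of sets on which the sequence is bounded gives pointwise
    boundedness on [Rg]. This becomes uniform below each member of [I], then on [I], and passes to
    complements through the value at [setT]. *)
Lemma large_Nikodym_set Q : Q `<=` Rg -> large Q -> @Nikodym_set R nat Rg Q.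
Proof.
move=> QR lQ; apply/(Nikodym_setP _ Rg0); split=> // mu bmu mu0.
have amu k : additive_on Rg (mu k) by have [] := bmu k.
have bmuI k : ba I (mu k) by apply: ba_sub (bmu k).
pose U k n := [set A | `|mu k A| <= n%:R].
have bU k n : @baire_family R I (U k n) by exact: baire_family_le.
have UU k n A B : Rg A -> Rg B -> A `&` B = set0 -> U k n A -> U k n B ->
    U k (n + n)%N (A `|` B).
  move=> RA RB AB UA UB; rewrite /U /= amu// natrD.
  by apply: le_trans (ler_normD _ _) _; exact: lerD.
have UD k n A B : Rg A -> Rg B -> A `<=` B -> U k n A -> U k n B ->
    U k (n + n)%N (B `\` A).
  move=> RA RB AB UA UB; rewrite /U /= (additive_onD RgR)// natrD.
  by apply: le_trans (ler_normB _ _) _; exact: lerD.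
have Umono k m n : (m <= n)%N -> U k m `<=` U k n.
  by move=> mn A /= UA; apply: le_trans UA _; rewrite ler_nat.
pose V := \bigcup_n \bigcap_k U k n.
have VR : Rg `<=` V.
  apply: lQ.
  - move=> A QA; have [n nP] := cvg_seq_bounded_nat (mu0 A QA).
    by exists n => // k _; exact: nP.
  - split.
    + by exists 0%N => // k _; rewrite /U /= (additive_on0 Rg0 (amu k)) normr0.
    + move=> A B RA RB AB [n _ UA] [m _ UB].
      exists (maxn n m + maxn n m)%N => // k _; apply: UU => //.
        by apply: Umono (UA k Logic.I); exact: leq_maxl.
      by apply: Umono (UB k Logic.I); exact: leq_maxr.
    + move=> A B RA RB AB [n _ UA] [m _ UB].
      exists (maxn n m + maxn n m)%N => // k _; apply: UD => //.
        by apply: Umono (UA k Logic.I); exact: leq_maxl.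
      by apply: Umono (UB k Logic.I); exact: leq_maxr.
  - by apply: baire_family_bigcup => n; apply: baire_family_bigcap.
have [|M MP] := ideal_uniformly_bounded hI hP fsI bmuI.
  move=> B IB.
  have [|||n [m0 UB]] := uniform_boundedness_principle hI bU Umono _ _ IB.
  - by move=> k n C D /IRg RC /IRg RD; exact: UU.
  - move=> k n C D ID CD; apply: UD => //; apply: IRg => //.
    exact: ideal_sub ID.
  - move=> A AB; have [|n _ UA] := VR A; first by apply: IRg; exact: ideal_sub IB.
    by exists n, 0%N => m _; exact: UA.
  (* The uniform bound holds only from [m0] on; the finitely many earlier functions are bounded
     separately. *)
  have /choice[C CP] : forall k, exists C, forall A, I A -> `|mu k A| <= C.
    by move=> k; have /(baP _ (ideal0 hI))[] := bmuI k.
  exists (n%:R + \sum_(k < m0) `|C k|) => k A AB.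
  have [m0k|km0] := leqP m0 k.
    apply: (@le_trans _ _ n%:R); first exact: UB.
    by rewrite lerDl; exact: sumr_ge0.
  have IA : I A by exact: ideal_sub IB.
  apply: le_trans (CP k A IA) _; apply: le_trans (ler_norm _) _.
  rewrite (bigD1 (Ordinal km0))//= addrCA lerDl addr_ge0//.
  exact: sumr_ge0.
have [K KP] : exists K : R, 0 <= K /\ (Rg setT -> forall k, `|mu k setT| <= K).
  have [RT|nRT] := pselect (Rg setT); last by exists 0; split.
  by have [n _ nP] := VR _ RT; exists n%:R; split=> // _ k; exact: (nP k).
exists (K + M) => k A RA; have [IA|[RT ICA]] := Rg_cases RA.
  by apply: le_trans (MP k _ IA) _; rewrite lerDr; case: KP.
rewrite -[A]setCK -setTD (additive_onD RgR (amu k) (IRg ICA) RT)//.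
apply: le_trans (ler_normB _ _) _; apply: lerD; last exact: MP.
by have [_ ->] := KP.
Qed.

(** If no term is large, each [Q_ m] lies in a family [V m] refuting it. The sets lying in [V m] for
    all large [m] include [Q], hence all of [Rg]. The uniform boundedness principle is contradicted
    by a [C] in [I] with subsets missing from infinitely many [V m]. *)
Lemma large_cover Q Q_ : Q `<=` Rg -> large Q -> increasing_cover Q Q_ ->
  exists m, large (Q_ m).
Proof.
move=> QR lQ [Qinc QU]; apply: contrapT => nl.
have /choice[V VP] : forall m, exists V, [/\ Q_ m `<=` V, additive_family V,
    @baire_family R I V & ~ Rg `<=` V].
  move=> m; apply: contrapT => nV; apply: nl; exists m => V QV aV bV.
  by apply: contrapT => nRV; apply: nV; exists V.
have Qle m n : (m <= n)%N -> Q_ m `<=` Q_ n.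
  move=> /subnK <-; elim: (n - m)%N => // d IH; rewrite addSn.
  exact: subset_trans (Qinc _).
have aV m : additive_family (V m) by have [] := VP m.
have bV m : @baire_family R I (V m) by have [] := VP m.
have VR : Rg `<=` \bigcup_k \bigcap_m V (k + m)%N.
  apply: lQ.
  - rewrite -QU => A [k _ QA]; exists k => // m _.
    by have [+ _ _ _] := VP (k + m)%N; apply; apply: Qle QA; exact: leq_addr.
  - split.
    + by exists 0%N => // m _; have [] := aV (0 + m)%N.
    + move=> A B RA RB AB [i _ VA] [j _ VB]; exists (i + j)%N => // m _.
      have [_ VU _] := aV (i + j + m)%N; apply: VU => //.
        by rewrite -addnA; exact: VA.
      by rewrite (addnC i) -addnA; exact: VB.
    + move=> A B RA RB AB [i _ VA] [j _ VB]; exists (i + j)%N => // m _.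
      have [_ _ VD] := aV (i + j + m)%N; apply: VD => //.
        by rewrite -addnA; exact: VA.
      by rewrite (addnC i) -addnA; exact: VB.
  - by apply: baire_family_bigcup => k; apply: baire_family_bigcap => m.
have {}VR A : Rg A -> exists k, forall m, (k <= m)%N -> V m A.
  by move=> /VR[k _ kP]; exists k => m /subnKC <-; exact: kP.
(* Once [setT], if in the ring, belongs to [V m], a missing set can be complemented and thus taken
   in [I]. *)
have [mT mTP] : exists mT, forall m, (mT <= m)%N -> exists2 A, I A & ~ V m A.
  have [k kP] : exists k, Rg setT -> forall m, (k <= m)%N -> V m setT.
    have [/VR[k kP]|nRT] := pselect (Rg setT); last by exists 0%N.
    by exists k.
  exists k => m km; have [_ _ _ /existsNP[A /not_implyP[RA nVA]]] := VP m.
  have [IA|[RT ICA]] := Rg_cases RA; first by exists A.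
  exists (~` A) => // VCA; apply: nVA; have [_ _ VD] := aV m.
  by rewrite -[A]setCK -setTD; apply: VD => //; [exact: IRg|exact: kP].
have /choice[A AP] : forall m, exists A, I A /\ ((mT <= m)%N -> ~ V m A).
  move=> m; have [/mTP[A IA nVA]|mm] := leqP mT m; first by exists A.
  by exists set0; split=> //; exact: ideal0.
have [B IB finB] := hP (fun m => (AP m).1).
suff [C IC uC] : exists2 C, I C &
    unbounded_nat [set m | exists2 E, E `<=` C & ~ V m E].
  have [||||n [m0 UC]] :=
    uniform_boundedness_principle hI (U := fun m _ => V m) (fun m _ => bV m)
      _ _ _ IC.
  - by move=> m n n' _.
  - move=> m _ E F IE IF; have [_ VU _] := aV m.
    by apply: VU; exact: IRg.
  - move=> m _ E F IF EF; have [_ _ VD] := aV m.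
    by apply: VD => //; apply: IRg => //; exact: ideal_sub IF.
  - move=> E EC; have [|k kP] := VR E; first by apply: IRg; exact: ideal_sub IC.
    by exists 0%N, k.
  have [m mm [E EC]] := uC m0; apply; exact: UC.
(* Either [A m] restricted to [B] is missing infinitely often, or eventually the finite remainder of
   [A m] is missing and supplies a missing singleton. *)
pose Z := [set m | (mT <= m)%N /\ ~ V m (A m `&` B)].
have [uZ|nuZ] := pselect (unbounded_nat Z).
  exists B => // n; have [m nm [_ nV]] := uZ n; exists m => //.
  by exists (A m `&` B).
have /existsNP[k0 k0P] := nuZ.
have /choice[a aP] : forall m, exists a,
    (mT <= m)%N -> (k0 <= m)%N -> ~ V m [set a].
  move=> m; have [mTm|] := leqP mT m; last by exists 0%N.
  have [k0m|] := leqP k0 m; last by exists 0%N.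
  have VAB : V m (A m `&` B).
    by apply: contrapT => nV; apply: k0P; exists m.
  have [_ VU _] := aV m; have [IA nVA] := AP m.
  have [|a _ nVa] := additive_family_singleton (aV m) (finB m); last by exists a.
  move=> VD; apply: (nVA mTm); rewrite -(setUIDK (A m) B); apply: VU => //.
  - by apply: IRg; apply: (ideal_sub hI _ IA) => x [].
  - by apply: IRg; apply: (ideal_sub hI _ IA) => x [].
  - by rewrite setDE setIACA setICr setI0.
have [|C IC uC] := ideal_meets_sequence fsI (Z := [set m | (maxn mT k0 <= m)%N]) a.
  by move=> n; exists (maxn n (maxn mT k0)) => /=; lia.
exists C => // n; have [m nm [/= mm Cam]] := uC n; exists m => //.
exists [set a m]; first by move=> _ ->.
by apply: aP; lia.
Qed.

(** The root is the ring itself, hence trivially large; [large_cover] selects a large child at every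
    node of the branch. *)
Lemma web_Nikodym_of_fs : web_Nikodym R Rg.
Proof.
move=> W [W0 Wcover].
have Wsub s n : W (rcons s n) `<=` W s.
  by have [_ <-] := Wcover s; move=> A WA; exists n.
have /choice[f fP] : forall s, exists m,
    W s `<=` Rg -> large (W s) -> large (W (rcons s m)).
  move=> s; have [WR|] := pselect (W s `<=` Rg); last by exists 0%N.
  have [lW|] := pselect (large (W s)); last by exists 0%N.
  by have [m] := large_cover WR lW (Wcover s); exists m.
pose s_ := fix s_ m := if m is m'.+1 then rcons (s_ m') (f (s_ m')) else [::].
have s_P m : W (s_ m) `<=` Rg /\ large (W (s_ m)).
  elim: m => [|m [WR lW]] /=; first by rewrite W0; split=> // V.
  by split; [exact: subset_trans WR|exact: fP].
exists s_; split=> m.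
- by elim: m => //= m IH; rewrite size_rcons IH.
- exact: prefix_rcons.
- by have [WR lW] := s_P m; exact: large_Nikodym_set.
Qed.

End web_Nikodym.

(** * Implications between the properties, and the equivalence *)

Section implications.
Context {R : realType}.

(** An increasing cover is the first level of a web that is constant below it. *)
Lemma web_strong_Nikodym (T : Type) (Rg : set (set T)) :
  web_Nikodym R Rg -> strong_Nikodym R Rg.
Proof.
move=> webN Rg_ [Rinc RU].
have [|s_ [size_s _ nik]] := webN (fun s => if s is n :: _ then Rg_ n else Rg).
  split=> // -[|n s]; first by split.
  by split=> [m|] /=; [exact: subset_refl|apply/seteqP];
    split=> [A [] //|A RA]; exists 0%N.
by case: (s_ 1%N) (size_s 1%N) (nik 1%N) => // n s _ nikn; exists n.
Qed.

Lemma strong_Nikodym_Nikodym (T : Type) (Rg : set (set T)) :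
  strong_Nikodym R Rg -> Nikodym R Rg.
Proof.
move=> /(_ (fun=> Rg))[|//]; split=> [n|]; first exact: subset_refl.
by apply/seteqP; split=> [A [] //|A RA]; exists 0%N.
Qed.

Context (I : set (set nat)) (hI : is_ideal I).

Lemma ideal_algebraP A : ideal_algebra I A <-> I A \/ I (~` A).
Proof.
split=> [[|[B IB <-]]|[|IA]]; [by left|by right; rewrite setCK|by left|].
by right; exists (~` A) => //; rewrite setCK.
Qed.

Lemma ideal_setCN A : I A -> ~ I (~` A).
Proof.
move=> IA ICA; apply: (ideal_proper hI).
by rewrite -(setUv A); exact: ideal_setU.
Qed.

Lemma ideal_algebra_Nikodym : Nikodym R (ideal_algebra I) -> Nikodym R I.
Proof.
have aR := ideal_algebra_setring hI; have [a0 _ _] := aR.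
have I0 := ideal0 hI; have iR := ideal_setring hI.
move=> /(Nikodym_setP _ a0)[_ nik].
apply/(Nikodym_setP _ I0); split=> // mu bmu mu0.
(* the extension with total mass 0 *)
pose ext (nu : set nat -> R) A := if pselect (I A) then nu A else - nu (~` A).
have extI nu A : I A -> ext nu A = nu A by rewrite /ext; case: pselect.
have extC nu A : I (~` A) -> ext nu A = - nu (~` A).
  by rewrite /ext; case: pselect => // IA /(ideal_setCN IA).
have [||M MP] := nik (fun k => ext (mu k)).
- move=> k; have /(baP _ I0)[amu [M muM]] := bmu k.
  apply/(baP _ a0); split; last first.
    exists M => A /ideal_algebraP[IA|IA]; first by rewrite extI// muM.
    by rewrite extC// normrN muM.
  have mixed A B : I A -> I (~` B) -> A `&` B = set0 ->
      ext (mu k) (A `|` B) = ext (mu k) A + ext (mu k) B.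
    move=> IA ICB AB.
    have AsubCB : A `<=` ~` B by apply/subsets_disjoint; rewrite setCK.
    have CE : ~` (A `|` B) = ~` B `\` A by rewrite setCU setIC setDE.
    rewrite extC; last by rewrite CE; apply: (ideal_sub hI _ ICB) => x [].
    rewrite CE (additive_onD iR amu)// extI// (extC _ B)//.
    by rewrite opprB.
  move=> A B /ideal_algebraP[IA|IA] /ideal_algebraP[IB|IB] AB.
  - by rewrite !extI// ?amu//; exact: ideal_setU.
  - exact: mixed.
  - by rewrite setUC addrC; apply: mixed; rewrite 1?setIC.
  (* Two complements of members of [I] cannot be disjoint, since [I] is proper. *)
  - exfalso; apply: (ideal_proper hI).
    by rewrite -setC0 -AB setCI; exact: ideal_setU.
- move=> A /ideal_algebraP[IA|IA].
    by apply: (eq_cvg0 _ (mu0 _ IA)) => k; rewrite extI.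
  have := mu0 _ IA; move/cvgN; rewrite oppr0 => mu0'.
  by apply: (eq_cvg0 _ mu0') => k; rewrite extC.
exists M => k A IA; rewrite -(extI (mu k) A IA); apply: MP.
by apply/ideal_algebraP; left.
Qed.

End implications.

Theorem theorem5p10 (R : realType) (I : set (set nat))
    (hI : is_ideal I) (hP : P_ideal I) :
  [<-> Nikodym R (ideal_algebra I);
       strong_Nikodym R (ideal_algebra I);
       web_Nikodym R (ideal_algebra I);
       Nikodym R I;
       strong_Nikodym R I;
       web_Nikodym R I;
       fs_Nikodym R (N_space hI)].
Proof.
have fs_webI : fs_Nikodym R (N_space hI) -> web_Nikodym R I.
  move=> /fs_Nikodym_ideal fsI; apply: (web_Nikodym_of_fs hI hP fsI) => //.
    exact: ideal_setring.
  by move=> A; left.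
have fs_webA : fs_Nikodym R (N_space hI) -> web_Nikodym R (ideal_algebra I).
  move=> /fs_Nikodym_ideal fsI; apply: (web_Nikodym_of_fs hI hP fsI).
  - exact: ideal_algebra_setring.
  - by move=> A; left.
  - move=> A /ideal_algebraP[|ICA]; [by left|right; split=> //].
    by apply/ideal_algebraP; right; rewrite setCT; exact: ideal0.
have NA_NI := @ideal_algebra_Nikodym R I hI.
have NI_fs := @ideal_Nikodym_fs R I hI.
(* Every property implies the finitely supported one, which returns the web property of both rings;
   the links of the cycle are read off from this. *)
have NA_webA := fs_webA \o NI_fs \o NA_NI.
tfae.
- by move=> /NA_webA /web_strong_Nikodym.
- by move=> /strong_Nikodym_Nikodym /NA_webA.
- by move=> /web_strong_Nikodym /strong_Nikodym_Nikodym /NA_NI.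
- by move=> /NI_fs /fs_webI /web_strong_Nikodym.
- by move=> /strong_Nikodym_Nikodym /NI_fs /fs_webI.
- by move=> /web_strong_Nikodym /strong_Nikodym_Nikodym /NI_fs.
- by move=> /fs_webA /web_strong_Nikodym /strong_Nikodym_Nikodym.
Qed.
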